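(* For every integer $n\ge 1$ and all $x\in(0,1)$, $$S^{(n)}(x)=P_{n-1}(S(x))\,\bigl(S'(x)\bigr)^n,$$ where, for each $n\geq 0$, $P_n$ is a polynomial of degree $n$, and these polynomials satisfy the recurrence $$P_0(x)=1,\qquad P_n(x)=P_{n-1}'(x)+n\,x\,P_{n-1}(x)\quad (n\ge 1),$$ so that $P_1(x)=x$, $P_2(x)=1+2x^2$, $P_3(x)=7x+6x^3$.
   Context: $N:\mathbb{R}\to(0,1)$ is $N(x)=\frac{1}{\sqrt{2\pi}}\int_{-\infty}^{x}e^{-t^2/2}\,dt$, and $S:(0,1)\to\mathbb{R}$ denotes its inverse. $S^{(n)}$ is the $n$-th derivative of $S$. *)

(* Defs.v *)
From HB Require Import structures.
From mathcomp Require Import all_boot all_order all_algebra.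
From mathcomp Require Import all_classical all_reals all_analysis.

Set Implicit Arguments.
Unset Strict Implicit.
Unset Printing Implicit Defensive.

Import Order.TTheory GRing.Theory Num.Theory.
Import numFieldNormedType.Exports.

Local Open Scope classical_set_scope.
Local Open Scope ring_scope.

Definition Ncdf {R : realType} (x : R) : R :=
  (Num.sqrt (2 * pi))^-1 *
  \int[@lebesgue_measure R]_(t in `]-oo, x]) expR (- t ^+ 2 / 2).

(* [pinv A f] is the library's total inverse of [f] on [A]; its values outside
   [f @` A], here outside ]0, 1[, are unspecified.  As ]0, 1[ is open, they do
   not affect the derivatives of [Ninv] at points of ]0, 1[. *)
Definition Ninv {R : realType} : R -> R := pinv [set: R] (@Ncdf R).

(* Main.v *)
(* The density phi = N' satisfies phi' = - x phi, so D := 1 / phi(S) = S'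
   satisfies D' = S D^2.  Differentiating P(S) D^n therefore gives
   (P' + n X P)(S) D^(n+1), which is the recurrence. *)

Require Import Defs.
From HB Require Import structures.
From mathcomp Require Import all_boot all_order all_algebra.
From mathcomp Require Import all_classical all_reals all_analysis.
From mathcomp Require Import ring.

Set Implicit Arguments.
Unset Strict Implicit.
Unset Printing Implicit Defensive.

Import Order.TTheory GRing.Theory Num.Theory.
Import numFieldNormedType.Exports.

Local Open Scope classical_set_scope.
Local Open Scope ring_scope.

(** The argument separates calculus of the normal law from an algebraic induction. With [phi] the
    standard normal density and [D = 1 / phi(S)], the only analytic facts used are [S' = D] and
    [D' = S D^2] on ]0, 1[. From them [derive1n_inv_normal_poly] shows by induction that the n-th
    derivative of S has derivative [P_n(S) D^(n+1)], each differentiation performing one step of the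
    recurrence. The first fact is the inverse function rule, once N is known to be differentiable
    with N' = [phi] > 0, hence injective, and onto ]0, 1[ by its limits at infinity. The second
    follows from [phi' = - x phi]. *)

Fixpoint inv_normal_poly (R : nzRingType) (n : nat) : {poly R} :=
  if n is m.+1 then
    (inv_normal_poly R m)^`() + m.+1%:R *: ('X * inv_normal_poly R m)
  else 1.

(** The term in ['X * P] raises the degree by exactly one, its coefficient [n.+1] being nonzero in
    characteristic 0, while the derivative has smaller degree and cannot cancel it. *)
Lemma size_inv_normal_poly (R : numDomainType) (n : nat) :
  size (inv_normal_poly R n) = n.+1.
Proof.
elim: n => [|n IHn] /=; first by rewrite size_poly1.
have P0 : inv_normal_poly R n != 0 by rewrite -size_poly_eq0 IHn.
have sXP : size (n.+1%:R *: ('X * inv_normal_poly R n)) = n.+2.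
  by rewrite size_scale ?pnatr_eq0// mulrC size_mulX// IHn.
rewrite addrC size_polyDl sXP// (leq_trans (lt_size_deriv P0))// IHn.
exact: leqnSn.
Qed.

(** Concluding with [is_derive] carries differentiability and the value through the induction
    together. *)
Lemma derive1n_inv_normal_poly (R : realType) (S D : R -> R) (a b : R) :
    (forall x, a < x < b -> is_derive x 1 S (D x)) ->
    (forall x, a < x < b -> is_derive x 1 D (S x * D x ^+ 2)) ->
  forall (n : nat) (x : R), a < x < b ->
    is_derive x 1 (derive1n n S)
      ((inv_normal_poly R n).[S x] * D x ^+ n.+1).
Proof.
move=> dS dD; elim=> [|n IHn] x xab; first by rewrite hornerC mul1r; exact: dS.
have derS : forall y, a < y < b ->
    (inv_normal_poly R n).[S y] * D y ^+ n.+1 = derive1n n.+1 S y.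
  by move=> y /IHn ?; rewrite derive1nS derive1E derive_val.
(* The closed form is known only on ]a, b[. Since this interval is open, the two functions agree
   near [x], which is enough to equate their derivatives. *)
have nearS : \near x, (inv_normal_poly R n).[S x] * D x ^+ n.+1 =
    derive1n n.+1 S x.
  have := @near_in_itvoo R a b x; rewrite in_itv/= => /(_ xab).
  by apply: filterS => y; rewrite in_itv/=; exact: derS.
have dSx := dS _ xab; have dDx := dD _ xab.
have dP : is_derive x 1 (fun y => (inv_normal_poly R n).[S y] * D y ^+ n.+1)
    ((inv_normal_poly R n.+1).[S x] * D x ^+ n.+2).
  have dPS := is_derive1_comp (is_derive_poly (inv_normal_poly R n) (S x)) dSx.
  have -> : (fun y => (inv_normal_poly R n).[S y] * D y ^+ n.+1) =
      (horner (inv_normal_poly R n) \o S) * (D ^+ n.+1).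
    by apply/funext => y; rewrite fctE exprfctE.
  apply: (@is_derive_eq _ _ _ _ _ _ _ _ (is_deriveM dPS (is_deriveX n.+1 dDx))).
  (* The product rule gives [P'(S) D * D^(n+1)] and [P(S) * (n+1) D^n * S D^2]; factoring out
     [D^(n+2)] leaves the recurrence evaluated at S. *)
  by rewrite /GRing.scale/= exprfctE hornerD hornerZ hornerM hornerX !exprS; ring.
have [dfP <-] := dP; apply: DeriveDef; first exact: near_eq_derivable dfP.
by apply/esym; exact: near_eq_derive.
Qed.

Section normal_cdf.
Variable R : realType.
Local Notation phi := (@normal_pdf R 0 1).

Lemma normal_pdf01E (x : R) :
  phi x = (Num.sqrt (2 * pi))^-1 * expR (- x ^+ 2 / 2).
Proof.
rewrite normal_pdfE ?oner_eq0// /normal_peak /normal_fun expr1n mul1r subr0.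
by rewrite -mulr_natl.
Qed.

Lemma normal_pdf01_gt0 (x : R) : 0 < phi x.
Proof.
by rewrite normal_pdf01E mulr_gt0 ?expR_gt0// invr_gt0 sqrtr_gt0 mulr_gt0 ?pi_gt0.
Qed.

Lemma NcdfE (x : R) : Ncdf x = \int[lebesgue_measure]_(t in `]-oo, x]) phi t.
Proof.
have c0 : (Num.sqrt (2 * pi : R))^-1 != 0.
  by rewrite invr_eq0 sqrtr_eq0 -ltNge mulr_gt0 ?pi_gt0.
rewrite /Ncdf -RintegralZl//.
  by apply: eq_Rintegral => t _; rewrite normal_pdf01E.
(* Integrability of the Gaussian is inherited from that of the density, of which it is a constant
   multiple. *)
have -> : EFin \o (fun t : R => expR (- t ^+ 2 / 2)) =
    (fun t => (Num.sqrt (2 * pi : R))%:E * (phi t)%:E)%E.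
  apply/funext => t /=.
  by rewrite normal_pdf01E -EFinM mulrA divff ?mul1r// -invr_eq0.
apply: integrableZl => //.
exact: integrableS (integrable_normal_pdf 0 1).
Qed.

Lemma is_derive_Ncdf (x : R) : is_derive x 1 Ncdf (phi x).
Proof.
have -> : Ncdf = fun x : R => \int[lebesgue_measure]_(t in `]-oo, x]) phi t.
  by apply/funext => y; rewrite NcdfE.
(* The bound [x + 1] is an arbitrary point to the right of [x], making [x] interior to the domain of
   integration. *)
have [] := @continuous_FTC1 R phi -oo%O x (x + 1).
- by rewrite ltrDl.
- exact: integrableS (integrable_normal_pdf 0 1).
- by rewrite ltNyr.
- by apply: continuous_normal_pdf; exact: oner_neq0.
- by move=> dF F'; apply: DeriveDef => //; rewrite -derive1E.
Qed.

Lemma is_derive_normal_pdf01 (x : R) : is_derive x 1 phi (- x * phi x).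
Proof.
have -> : phi = fun t => (Num.sqrt (2 * pi))^-1 * expR (- t ^+ 2 / 2).
  by apply/funext => t; rewrite normal_pdf01E.
have dq : is_derive x 1 (fun t : R => - t ^+ 2 / 2) (- x).
  have -> : (fun t : R => - t ^+ 2 / 2) = horner (- (2^-1 *: 'X^2)).
    by apply/funext => t; rewrite hornerN hornerZ hornerXn mulNr mulrC.
  apply: is_derive_eq; rewrite derivN derivZ derivXn hornerN hornerZ hornerMn hornerXn.
  by rewrite /= expr1; field.
have de := @is_derive1_comp _ expR _ x _ _ (is_derive_expR _) dq.
apply: (is_derive_eq (is_deriveZ (Num.sqrt (2 * pi))^-1 de)).
by rewrite /GRing.scale/=; ring.
Qed.

Lemma Ncdf_continuous : continuous (@Ncdf R).
Proof.
move=> x; apply/differentiable_continuous/derivable1_diffP.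
by have [] := is_derive_Ncdf x.
Qed.

Lemma Ncdf_lt : {homo @Ncdf R : x y / x < y}.
Proof.
move=> x y xy; apply: (@gtr0_derive1_lt_cc _ _ x y) => //.
- by move=> z _; have [] := is_derive_Ncdf z.
- move=> z _; have dz := is_derive_Ncdf z.
  by rewrite derive1E derive_val normal_pdf01_gt0.
- exact/continuous_subspaceT/Ncdf_continuous.
- by rewrite in_itv/= lexx ltW.
- by rewrite in_itv/= lexx ltW.
Qed.

Lemma Ncdf_inj : injective (@Ncdf R).
Proof. exact/inc_inj/le_mono/Ncdf_lt. Qed.

(** The identity, seen as a random variable under the standard normal law, has N as its distribution
    function; the limits of N at both infinities are then those of any [cdf]. *)
Let idTR : measurableTypeR R -> R := idfun.

#[local] HB.instance Definition _ :=
  @isMeasurableFun.Build _ _ _ _ idTR (@measurable_id _ _ setT).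

Let Ncdf_cdf :
  @Ncdf R = fine \o cdf (idTR : {RV (normal_prob (0 : R) 1) >-> R}).
Proof. by apply/funext => x; rewrite NcdfE. Qed.

Lemma cvg_Ncdfy1 : @Ncdf R @ +oo --> (1 : R).
Proof. by rewrite Ncdf_cdf; exact/fine_cvg/cvg_cdfy1. Qed.

Lemma cvg_NcdfNy0 : @Ncdf R @ -oo --> (0 : R).
Proof. by rewrite Ncdf_cdf; exact/fine_cvg/cvg_cdfNy0. Qed.

Lemma Ncdf_surj (y : R) : 0 < y < 1 -> exists x, Ncdf x = y.
Proof.
move=> /andP[y0 y1].
near (ninfty_nbhs R) => a; near (pinfty_nbhs R) => b.
have Nay : Ncdf a < y by near: a; exact: cvgr_lt cvg_NcdfNy0 _ y0.
have yNb : y < Ncdf b by near: b; exact: cvgr_gt cvg_Ncdfy1 _ y1.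
have Nab := lt_trans Nay yNb.
have ab : a <= b.
  by rewrite leNgt; apply: contraTN Nab => /Ncdf_lt/ltW; rewrite -leNgt.
have [||c _ Nc] := @IVT R (@Ncdf R) a b y ab; last by exists c.
- exact/continuous_subspaceT/Ncdf_continuous.
- by rewrite ge_min le_max (ltW Nay) (ltW yNb) orbT.
Unshelve. all: by end_near. Qed.

(** Injectivity of N makes [pinv] a left inverse on the whole line; surjectivity onto ]0, 1[ then
    makes it a right inverse there. *)
Lemma NcdfK : cancel (@Ncdf R) Ninv.
Proof.
by move=> x; apply: pinvKV; rewrite ?inE// => y z _ _; exact: Ncdf_inj.
Qed.

Lemma NinvK (x : R) : 0 < x < 1 -> Ncdf (Ninv x) = x.
Proof. by move=> /Ncdf_surj[y <-]; rewrite NcdfK. Qed.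

Lemma is_derive_Ninv (x : R) : 0 < x < 1 ->
  is_derive x 1 Ninv (phi (Ninv x))^-1.
Proof.
(* The inverse function rule applies at a point of the form N(y), so [x] is written as N(S(x)). *)
move=> x01; rewrite -[X in is_derive X](NinvK x01).
apply: is_derive_inverse (is_derive_Ncdf _) _.
- by near=> z; exact: NcdfK.
- by near=> z; exact: Ncdf_continuous.
- by rewrite gt_eqF// normal_pdf01_gt0.
Unshelve. all: by end_near. Qed.

(** This is [D' = S D^2]: the chain rule gives [- phi'(S) S' / phi(S)^2], where
    [phi'(S) = - S phi(S)] and [S' = 1 / phi(S)]. *)
Lemma is_derive_normal_pdf01_Ninv (x : R) : 0 < x < 1 ->
  is_derive x 1 (fun y => (phi (Ninv y))^-1)
    (Ninv x * (phi (Ninv x))^-1 ^+ 2).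
Proof.
move=> x01.
have phi0 : phi (Ninv x) != 0 by rewrite gt_eqF// normal_pdf01_gt0.
have d := is_derive1_comp (is_derive_normal_pdf01 (Ninv x)) (is_derive_Ninv x01).
apply: (is_derive_eq (@is_deriveV _ (phi \o Ninv) _ _ _ phi0 d)).
by rewrite /GRing.scale/=; field.
Qed.

End normal_cdf.

Theorem proposition5 (R : realType) :
  exists P : nat -> {poly R},
    [/\ forall n : nat, size (P n) = n.+1,
        P 0%N = 1 /\
        (forall n : nat, (1 <= n)%N ->
           P n = ((P n.-1)^`())%R + n%:R *: ('X * P n.-1)),
        [/\ P 1%N = 'X,
            P 2%N = 1 + 2%:R *: 'X^2 &
            P 3%N = 7%:R *: 'X + 6%:R *: 'X^3] &
        forall (n : nat) (x : R), (1 <= n)%N -> 0 < x < 1 ->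
          derivable (derive1n n.-1 (@Ninv R)) x 1 /\
          derive1n n (@Ninv R) x =
            (P n.-1).[Ninv x] * (derive1 (@Ninv R) x) ^+ n].
Proof.
exists (inv_normal_poly R).
have PS n : inv_normal_poly R n.+1 =
  (inv_normal_poly R n)^`() + n.+1%:R *: ('X * inv_normal_poly R n) by [].
have P1 : inv_normal_poly R 1 = 'X.
  by rewrite PS /= -polyC1 derivC add0r scale1r polyC1 mulr1.
have P2 : inv_normal_poly R 2 = 1 + 2%:R *: 'X^2 by rewrite PS P1 derivX -expr2.
split; [exact: size_inv_normal_poly|by split=> // -[]| |].
- split=> //; rewrite PS P2 derivD -polyC1 derivC derivZ derivXn.
  by rewrite -!mul_polyC !polyC_natr /=; ring.
- move=> [//|n] x _ x01 /=.
  (* This identifies [D] with S' at [x], so the abstract formula in powers of [D] becomes one in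
     powers of S'. *)
  have dS := is_derive_Ninv x01.
  have dSn := derive1n_inv_normal_poly (@is_derive_Ninv R)
    (@is_derive_normal_pdf01_Ninv R) n x01.
  by split; [case: dSn|rewrite -derive1nS derive1nS !derive1E !derive_val].
Qed.
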